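(* Let $B$ be a complete Boolean algebra, and let $G_B=\{(b,\neg b):b\in B\}\subseteq B^2$ carry the subspace topology inherited from the Scott space $\Sigma B^2$. If $G_B$ contains a non-singleton compact irreducible subspace $M$, then $\Sigma B^2$ is not co-sober.
   Context: For a Boolean algebra $B$, $\neg b$ denotes the complement of $b$, and $B^2=B\times B$ carries the coordinatewise order and operations. A subset $U$ of a poset $P$ is Scott open if it is an upper set and, whenever a directed (in particular nonempty) set $D\subseteq P$ has a supremum with $\bigvee D\in U$, one has $D\cap U\neq\varnothing$; $\Sigma P$ denotes $P$ with the topology of Scott open sets. Its specialization order is the original order of $P$. A nonempty subspace $Y$ of a space is irreducible if every two nonempty open subsets of $Y$ intersect. Compactness means that every open cover has a finite subcover (no separation axiom is assumed). A subset of a $T_0$-space is saturated if it is an intersection of open sets (equivalently, an upper set in the specialization order, where $x\leq y$ iff $x\in\operatorname{cl}\{y\}$). For a $T_0$-space $X$, let $\mathcal{Q}(X)$ be the family of nonempty compact saturated subsets of $X$. An element $K\in\mathcal{Q}(X)$ is $k$-irreducible if $K=K_1\cup K_2$ with $K_1,K_2\in\mathcal{Q}(X)$ implies $K=K_1$ or $K=K_2$. The space $X$ is co-sober if every $k$-irreducible $K\in\mathcal{Q}(X)$ has the form ${\uparrow}x=\{y\in X: x\leq y\}$ (specialization order) for some point $x\in X$. *)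

(* Defs.v *)
From HB Require Import structures.
From mathcomp Require Import all_boot all_order all_classical.
From mathcomp Require Import topology_structure compact separation_axioms.
From mathcomp Require Import initial_topology subtype_topology.

Set Implicit Arguments.
Unset Strict Implicit.
Unset Printing Implicit Defensive.

Import Order.TTheory.
Local Open Scope classical_set_scope.
Local Open Scope order_scope.

Definition complete_order d (P : porderType d) : Prop :=
  forall A : set P, supremums A !=set0.

Section ScottTopology.
Context {d : Order.disp_t} {P : porderType d}.

Definition directed (D : set P) : Prop :=
  D !=set0 /\
  forall x y, D x -> D y -> exists z, [/\ D z, x <= z & y <= z].

Definition scott_open (U : set P) : Prop :=
  (forall x y, U x -> x <= y -> U y) /\
  (forall (D : set P) (s : P),
     directed D -> supremums D s -> U s -> D `&` U !=set0).

Lemma scott_openT : scott_open setT.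
Proof. by split=> // D s [[x Dx] _] _ _; exists x. Qed.

Lemma scott_openI : setI_closed scott_open.
Proof.
move=> U V [Uup Usup] [Vup Vsup]; split.
  by move=> x y [Ux Vx] xy; split; [exact: Uup Ux xy|exact: Vup Vx xy].
move=> D s Ddir Ds [Us Vs].
have [x [Dx Ux]] := Usup D s Ddir Ds Us.
have [y [Dy Vy]] := Vsup D s Ddir Ds Vs.
have [z [Dz xz yz]] := Ddir.2 _ _ Dx Dy.
by exists z; split=> //; split; [exact: Uup Ux xz|exact: Vup Vy yz].
Qed.

Lemma scott_open_bigcup (I : Type) (f : I -> set P) :
  (forall i, scott_open (f i)) -> scott_open (\bigcup_i f i).
Proof.
move=> fo; split.
  by move=> x y [i _ fx] xy; exists i => //; exact: (fo i).1 fx xy.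
move=> D s Ddir Ds [i _ fs].
by have [x [Dx fx]] := (fo i).2 D s Ddir Ds fs; exists x; split=> //; exists i.
Qed.

End ScottTopology.

(* A copy of P carrying the Scott topology; on a product order B *p B it must
   not be confused with the product topology on pairs. *)
Definition scott d (P : porderType d) : Type := P.

Section ScottInstance.
Context {d : Order.disp_t} {P : porderType d}.

HB.instance Definition _ := Choice.copy (scott P) P.
HB.instance Definition _ := isOpenTopological.Build (scott P)
  (@scott_openT d P) (@scott_openI d P) (@scott_open_bigcup d P).

Lemma open_scottE (U : set (scott P)) : open U = scott_open (U : set P).
Proof. by []. Qed.

End ScottInstance.

Section CoSober.
Variable X : topologicalType.
Implicit Types (x y : X) (K : set X).

(* For Y : set X this says that Y is irreducible as a subspace of X: the open
   sets of the subspace Y are the traces Y `&` U with U open in X. *)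
Definition irreducible (Y : set X) : Prop :=
  Y !=set0 /\
  forall U V : set X, open U -> open V ->
    Y `&` U !=set0 -> Y `&` V !=set0 -> (Y `&` U) `&` (Y `&` V) !=set0.

Definition spec_le x y : Prop := closure [set y] x.

Definition spec_up x : set X := [set y | spec_le x y].

Definition saturated K : Prop :=
  exists2 F : set (set X), F `<=` open & K = \bigcap_(U in F) U.

Definition compact_saturated K : Prop :=
  [/\ K !=set0, cover_compact K & saturated K].

Definition k_irreducible K : Prop :=
  compact_saturated K /\
  forall K1 K2, compact_saturated K1 -> compact_saturated K2 ->
    K = K1 `|` K2 -> K = K1 \/ K = K2.

(* The notion is only considered for T0-spaces; Scott spaces are T0, see
   scott_kolmogorov below. *)
Definition co_sober : Prop :=
  forall K, k_irreducible K -> exists x, K = spec_up x.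

End CoSober.
Arguments co_sober : clear implicits.

Section ScottSpecialization.
Context {d : Order.disp_t} {P : porderType d}.

Lemma scott_open_nle (y : P) : scott_open [set z | ~ (z <= y)].
Proof.
split=> [a b ay ab byy|D s Ddir [Dub Dlub] sy]; first exact/ay/(le_trans ab).
apply: contrapT => /forallNP Dy; apply: sy; apply: Dlub => z Dz.
by apply: contrapT => zy; apply: (Dy z).
Qed.

Lemma scott_spec_le (x y : scott P) : spec_le x y <-> (x : P) <= (y : P).
Proof.
split=> [xy|xy U].
  apply: contrapT => nxy.
  have : nbhs x [set z : scott P | ~ ((z : P) <= (y : P))].
    by apply: open_nbhs_nbhs; split=> //; exact: scott_open_nle.
  by move=> /xy[_ [/= ->]]; rewrite lexx.
rewrite nbhsE => -[V [oV Vx] VU]; exists y; split=> //.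
by apply: VU; exact: (oV : scott_open _).1 Vx xy.
Qed.

Lemma scott_kolmogorov : @kolmogorov_space (scott P).
Proof.
have sep (x y : scott P) : ~ ((x : P) <= (y : P)) ->
    [set z : scott P | ~ ((z : P) <= (y : P))] \in nbhs x /\
    y \in ~` [set z : scott P | ~ ((z : P) <= (y : P))].
  move=> nxy; rewrite !inE; split.
    by apply: open_nbhs_nbhs; split=> //; exact: scott_open_nle.
  by move=> /=; rewrite lexx => /(_ isT).
move=> x y xy; have [yx|/negP/sep] := boolP ((x : P) <= (y : P)); last first.
  by exists [set z : scott P | ~ ((z : P) <= (y : P))]; left.
exists [set z : scott P | ~ ((z : P) <= (x : P))]; right; apply: sep => xy'.
by move/eqP: xy; apply; apply/(@le_anti _ P); rewrite yx xy'.
Qed.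

End ScottSpecialization.

Definition compl_graph d (B : ctbDistrLatticeType d) : set (scott (B *p B)) :=
  range (fun b : B => (b, Order.compl b)).
Arguments compl_graph {d} B _.

(* Main.v *)
(* Two distinct points of [G_B] have a join [(x, y)] with [x `&` y] different
   from [\bot], and [W = {(x, y) | x `&` y != \bot}] is Scott open and disjoint
   from [G_B]. If [K] is Scott compact, then [{z | z `|` k \in W for all k in K}]
   is Scott open; when [K] lies above points of [G_B], this set contains every
   point of [G_B] outside [K], and it contains no point of [G_B] in [K]. So
   compact saturated sets have relatively closed traces on [G_B], and a
   decomposition of the upper closure of [M] into two compact saturated sets
   gives one of the irreducible set [M] into two closed sets. As [G_B] is an
   antichain, the upper closure of [M] is principal only if [M] is a singleton. *)

Require Import Defs.
From mathcomp Require Import all_boot all_order all_classical.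
From mathcomp Require Import topology_structure compact subtype_topology.

Local Open Scope classical_set_scope.
Local Open Scope order_scope.

Set Implicit Arguments.
Unset Strict Implicit.
Unset Printing Implicit Defensive.

Import Order.Theory.

Section ScottFacts.
Context {d : Order.disp_t} {P : porderType d}.

Lemma directed_seq_ub (D : set P) (s : seq P) :
  directed D -> (forall x, x \in s -> D x) ->
  exists2 z, D z & forall x, x \in s -> x <= z.
Proof.
move=> [[x0 Dx0] Ddir]; elim: s => [_|a s IHs sD]; first by exists x0.
have [|z Dz sz] := IHs; first by move=> x xs; apply: sD; rewrite in_cons xs orbT.
have [w [Dw aw zw]] := Ddir _ _ (sD a (mem_head _ _)) Dz.
exists w => // x; rewrite in_cons => /predU1P[->//|/sz xz].
exact: le_trans xz zw.
Qed.

Lemma saturated_upper (K : set (scott P)) (x y : P) :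
  saturated K -> K x -> x <= y -> K y.
Proof.
move=> [F Fo ->] Kx xy U FU.
have [Uup _] : scott_open (U : set P) by exact: Fo.
exact: Uup (Kx _ FU) xy.
Qed.

(** An upper set is the intersection of the complements of the principal ideals of the points
    outside it. *)
Lemma upper_saturated (K : set (scott P)) :
  (forall x y : P, K x -> x <= y -> K y) -> saturated K.
Proof.
move=> Kup.
exists [set U | exists2 y : P, ~ K y & U = [set z : P | ~ (z <= y)]].
  by move=> _ [y _ ->]; exact: scott_open_nle.
apply/seteqP; split=> [x Kx _ [y nKy ->] xy|x Fx].
  exact/nKy/(Kup x).
apply: contrapT => nKx.
have /= : [set z : P | ~ (z <= x)] x by apply: Fx; exists x.
by apply.
Qed.

Lemma spec_up_scott (x : scott P) :
  spec_up x = [set y | (x : P) <= (y : P)].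
Proof. by apply/seteqP; split=> y /= /scott_spec_le. Qed.

End ScottFacts.

Section JoinCompact.
Context {d : Order.disp_t} {L : joinSemilatticeType d}.

(** Joining with a fixed [z] preserves directed suprema; a member [x0] of [D] is what puts [z] below
    every upper bound of the translated set. *)
Lemma scott_open_joinl (W : set L) (z : L) :
  scott_open W -> scott_open [set k | W (z `|` k)].
Proof.
move=> [Wup Wsup]; split=> [x y /= Wx xy|D s [[x0 Dx0] Ddir] [Dub Dlub] /= Ws].
  by apply: Wup Wx _; exact: leU2.
have [||_ [[x Dx <-] Wx]] := Wsup [set z `|` x | x in D] (z `|` s) _ _ Ws;
  last by exists x.
- split; first by exists (z `|` x0), x0.
  move=> _ _ [x Dx <-] [y Dy <-]; have [w [Dw xw yw]] := Ddir _ _ Dx Dy.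
  by exists (z `|` w); split; [exists w|exact: leU2|exact: leU2].
- split=> [_ [x Dx <-]|u uD]; first exact: leU2 (lexx z) (Dub _ Dx).
  rewrite leUx; apply/andP; split.
    by apply: le_trans (uD _ (ex_intro2 _ _ _ Dx0 erefl)); exact: leUl.
  apply: Dlub => x Dx; apply: le_trans (uD _ (ex_intro2 _ _ _ Dx erefl)).
  exact: leUr.
Qed.

Lemma scott_open_join_compact (W : set L) (K : set (scott L)) :
  scott_open W -> cover_compact K ->
  scott_open [set z : L | forall k : L, K k -> W (z `|` k)].
Proof.
move=> Wo Kc; have [Wup _] := Wo.
split=> [x y Wx xy k Kk|D s Ddir Ds Ws].
  by apply: Wup (Wx _ Kk) _; exact: leU2.
(* The cover of [K] is indexed by [D]. An upper bound in [D] of the indices of a finite subcover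
   then serves all of [K] at once. *)
have [|k Kk|F FD KF] := Kc L D (fun z => [set k : scott L | W (z `|` (k : L))]).
- by move=> z _; exact: scott_open_joinl.
- have := Ws k Kk; rewrite joinC.
  move=> /((scott_open_joinl k Wo).2 D s Ddir Ds)[x [Dx Wx]].
  by exists x => //=; rewrite joinC.
have [|z Dz Fz] := directed_seq_ub (s := finmap.enum_fset F) Ddir.
  by move=> x /FD; rewrite inE.
exists z; split=> // k /KF[x Fx Wx]; apply: Wup Wx _.
by apply: leU2 => //; exact: Fz.
Qed.

End JoinCompact.

Section ComplementGraph.
Context {d : Order.disp_t} {B : ctbDistrLatticeType d}.
Implicit Types (z : B *p B).

Definition overlap : set (B *p B) := [set z | z.1 `&` z.2 != \bot].

(** If a directed [D] avoids [overlap], common upper bounds make [x.1] and [y.2] disjoint for all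
    [x], [y] in [D]. Disjointness is an inequality against a complement, so it passes to the
    supremum one coordinate at a time. *)
Lemma scott_open_overlap : scott_open overlap.
Proof.
split=> [x y /= x0|D s [_ Ddir] [Dub Dlub] /=].
  rewrite leEprod => /andP[xy1 xy2]; apply: contra_neq x0 => y0.
  by apply/eqP; rewrite -lex0 -y0; exact: leI2.
move=> s0; apply: contrapT => /forallNP nD; move/negP: s0; apply.
have D0 x y : D x -> D y -> x.1 `&` y.2 = \bot.
  move=> Dx Dy; have [w [Dw]] := Ddir _ _ Dx Dy.
  rewrite !leEprod => /andP[xw _] /andP[_ yw].
  apply/eqP; rewrite -lex0; apply: le_trans (leI2 xw yw) _; rewrite lex0.
  by apply: contrapT => /negP w0; exact: (nD w).
(* One coordinate of [s] is bounded by comparing [s] with a pair whose other coordinate is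
   [\top]. *)
have s1 y : D y -> s.1 <= ~` y.2.
  move=> Dy; have : s <= ((~` y.2, \top) : B *p B).
    apply: Dlub => x Dx; rewrite leEprod lex1 andbT /= -disj_leC.
    by apply/eqP; exact: D0.
  by rewrite leEprod => /andP[].
rewrite meetC disj_leC.
have : s <= ((\top, ~` s.1) : B *p B).
  apply: Dlub => y Dy; rewrite leEprod lex1 /= -disj_leC meetC disj_leC.
  exact: s1.
by rewrite leEprod => /andP[].
Qed.

Lemma compl_graph_overlap z : compl_graph B z -> ~ overlap z.
Proof. by move=> [b _ <-]; rewrite /overlap/= meetxC eqxx. Qed.

Lemma compl_graph_antichain (x y : B *p B) :
  compl_graph B x -> compl_graph B y -> x <= y -> x = y.
Proof.
move=> [a _ <-] [b _ <-]; rewrite leEprod /= leC => /andP[ab ba].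
by have -> : a = b by apply/le_anti; rewrite ab ba.
Qed.

(** If the coordinates of the join were disjoint, De Morgan would give [k1 <= a] and [k2] below the
    complement of [a], that is, [k <= m]. *)
Lemma compl_graph_join_overlap (m k : B *p B) :
  compl_graph B m -> ~ (k <= m) -> overlap (m `|` k).
Proof.
move=> [a _ <-]; case: k => k1 k2 km.
rewrite /overlap joinEprod /=; apply: contra_notN km.
rewrite disj_leC complU complK leUx !lexI => /andP[/andP[_ ak2] /andP[k1a _]].
by rewrite leEprod /= k1a lexC.
Qed.

Lemma compl_graph_avoid_compact (K M : set (scott (B *p B))) (m : B *p B) :
  M `<=` compl_graph B -> saturated K -> cover_compact K ->
  (forall k : B *p B, K k -> exists2 g : B *p B, M g & g <= k) ->
  M m -> ~ K m ->
  exists V : set (scott (B *p B)),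
    [/\ open V, V m & forall x, M x -> V x -> ~ K x].
Proof.
move=> MG Ksat Kc KM Mm nKm.
exists [set z : B *p B | forall k : B *p B, K k -> overlap (z `|` k)]; split.
- exact: scott_open_join_compact scott_open_overlap Kc.
- move=> k Kk; apply: compl_graph_join_overlap; first exact: MG.
  (* The chain [g <= k <= m] collapses by the antichain property, which would put [m] in [K]. *)
  move=> km; apply: nKm; have [g Mg gk] := KM k Kk.
  have gm : g = m by apply: compl_graph_antichain (le_trans gk km); exact: MG.
  by have -> : m = k by apply/le_anti; rewrite km -gm gk.
- move=> x Mx Vx Kx; apply: (@compl_graph_overlap x); first exact: MG.
  by rewrite -[x in overlap x](joinxx (x : B *p B)); exact: Vx.
Qed.

Lemma upper_closure_k_irreducible (M : set (scott (B *p B))) :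
  M `<=` compl_graph B -> cover_compact M -> irreducible M ->
  k_irreducible
    [set y : scott (B *p B) | exists2 x : B *p B, M x & x <= (y : B *p B)].
Proof.
move=> MG Mc [[m0 Mm0] Mirr]; set K := (X in k_irreducible X).
have MK : M `<=` K by move=> x Mx; exists x.
split.
  split; first by exists m0; exact: MK.
    (* Scott open sets are upper, so a finite subfamily covering [M] also covers [K]. *)
    move=> I D f fo Kf.
    have [F FD MF] := Mc I D f fo (subset_trans MK Kf).
    exists F => // y [x /MF[i Fi fx] xy]; exists i => //.
    have [fup _] : scott_open (f i : set (B *p B)).
      by apply: fo; have /= := FD _ Fi; rewrite inE.
    exact: fup fx xy.
  apply: upper_saturated => x y [m Mm mx] xy.
  by exists m => //; exact: le_trans mx xy.
move=> K1 K2 [_ K1c K1s] [_ K2c K2s] KE.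
have K1K : K1 `<=` K by rewrite KE => x; left.
have K2K : K2 `<=` K by rewrite KE => x; right.
have full K' : saturated K' -> K' `<=` K -> M `<=` K' -> K = K'.
  move=> K's K'K MK'; apply/seteqP; split=> // y [x Mx xy].
  exact: saturated_upper K's (MK' x Mx) xy.
have [/(full _ K1s K1K)|nM1] := pselect (M `<=` K1); first by left.
have [/(full _ K2s K2K)|nM2] := pselect (M `<=` K2); first by right.
exfalso.
have [m1 [Mm1 nK1]] := nonsubset nM1.
have [m2 [Mm2 nK2]] := nonsubset nM2.
have [V1 [oV1 V1m V1K]] := compl_graph_avoid_compact MG K1s K1c K1K Mm1 nK1.
have [V2 [oV2 V2m V2K]] := compl_graph_avoid_compact MG K2s K2c K2K Mm2 nK2.
(* Irreducibility yields a point of [M] that avoids both [K1] and [K2]. *)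
have [||x [[Mx V1x] [_ V2x]]] := Mirr _ _ oV1 oV2.
- by exists m1.
- by exists m2.
have : K x by exact: MK.
by rewrite KE => -[]; [exact: V1K|exact: V2K].
Qed.

End ComplementGraph.

Section SetType.
Context {X : topologicalType} {A : set X}.

Lemma open_preimage_set_val (U : set X) :
  open U -> open (set_val @^-1` U : set (set_type A)).
Proof. by move=> oU; exists U. Qed.

Lemma cover_compact_set_val (M : set (set_type A)) :
  cover_compact M -> cover_compact (set_val @` M).
Proof.
move=> Mc I D f fo Mf.
have [|x Mx|F FD MF] := Mc I D (fun i => set_val @^-1` f i).
- by move=> i Di; apply: open_preimage_set_val; exact: fo.
- by have [|i Di fx] := Mf (set_val x); [exists x|exists i].
by exists F => // _ [x /MF[i Fi fx] <-]; exists i.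
Qed.

Lemma irreducible_set_val (M : set (set_type A)) :
  irreducible M -> irreducible (set_val @` M).
Proof.
move=> [[m Mm] Mirr]; split; first by exists (set_val m), m.
move=> U V oU oV [_ [[x Mx <-] Ux]] [_ [[y My <-] Vy]].
have [||z [[Mz Uz] [_ Vz]]] := Mirr _ _ (open_preimage_set_val oU)
  (open_preimage_set_val oV).
- by exists x.
- by exists y.
by exists (set_val z); split; split=> //; exists z.
Qed.

End SetType.

Theorem theorem3p4 (d : Order.disp_t) (B : ctbDistrLatticeType d)
    (B_complete : complete_order B)
    (M : set (set_type (compl_graph B)))
    (M_compact : cover_compact M)
    (M_irreducible : irreducible M)
    (M_nonsingleton : ~ exists x, M = [set x]) :
  ~ co_sober (scott (B *p B)).
Proof.
have MG : set_val @` M `<=` compl_graph B by move=> _ [x _ <-]; exact: set_valP.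
move=> /(_ _ (upper_closure_k_irreducible MG (cover_compact_set_val M_compact)
  (irreducible_set_val M_irreducible))) [x].
rewrite spec_up_scott => /seteqP[Kx xK].
(* The generator [x] lies above some [m] of [M] and below every [n] of [M], so [m <= n] and the
   antichain property gives [m = n]. *)
have [_ [m Mm <-] mx] := xK x (lexx (x : B *p B)).
apply: M_nonsingleton; exists m; apply/seteqP; split=> [n Mn|_ ->//].
apply: val_inj; apply/esym/compl_graph_antichain.
- by apply: MG; exists m.
- by apply: MG; exists n.
- apply: le_trans mx _; apply: (Kx (set_val n)).
  by exists (set_val n); first exists n.
Qed.
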